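(* Let $p\ge 3$ be real, $p'=\frac{p}{p-1}$, and $$\beta(3,p)=\frac{2\ln 2}{(p-2)\ln 3+2\ln 2}.$$ Let $(X,\mu)$ be a measure space. Then for all $f_1,f_2,f_3\in L^p(X,\mu)$, not all zero, $$\Big\|\sum_{j=1}^3 f_j\Big\|_p\le\Big(1+2\,\Gamma_p(f_1,f_2,f_3)^{\beta(3,p)}\Big)^{1/p'}\Big(\sum_{j=1}^3\|f_j\|_p^p\Big)^{1/p}.$$
   Context: Definition: $$\Gamma_p(f_1,f_2,f_3)=\frac{\Big\|\frac13\big(|f_1f_2|+|f_1f_3|+|f_2f_3|\big)\Big\|_{p/2}^{p/2}}{\frac13\big(\|f_1\|_p^p+\|f_2\|_p^p+\|f_3\|_p^p\big)}\in[0,1],$$ where $\|f\|_q=(\int_X|f|^q\,d\mu)^{1/q}$. *)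

(* Defs.v *)
From HB Require Import structures.
From mathcomp Require Import all_boot all_order all_algebra.
From mathcomp Require Import all_classical all_reals all_analysis.
From mathcomp Require Import complex.

Set Implicit Arguments.
Unset Strict Implicit.
Unset Printing Implicit Defensive.

Import Order.TTheory GRing.Theory Num.Theory.
Import numFieldNormedType.Exports.

Local Open Scope classical_set_scope.
Local Open Scope ring_scope.

(* The library norm `|z| of z : R[i] lives in R[i]; it is a nonnegative real
   number, and its real part is the usual modulus in R. *)
Definition cmod (R : realType) (z : R[i]) : R := complex.Re `|z|.

Definition cLnorm d (T : measurableType d) (R : realType)
    (mu : {measure set T -> \bar R}) (p : R) (f : T -> R[i]) : \bar R :=
  'N[mu]_(p%:E)[(fun x => (cmod (f x))%:E)]%E.

(* Representatives of the elements of L^p(mu); real-valued functions are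
   included through the embedding of R in R[i]. *)
Definition cLfun d (T : measurableType d) (R : realType)
    (mu : {measure set T -> \bar R}) (p : R) : set (T -> R[i]) :=
  [set f | [/\ measurable_fun [set: T] (fun x => complex.Re (f x)),
               measurable_fun [set: T] (fun x => complex.Im (f x)) &
               (cLnorm mu p f < +oo)%E]].

(* All the norms below are finite when f1, f2, f3 belong to L^p(mu) and 0 < p,
   so that [fine] loses no information. *)
Definition Gamma d (T : measurableType d) (R : realType)
    (mu : {measure set T -> \bar R}) (p : R) (f1 f2 f3 : T -> R[i]) : R :=
  fine ('N[mu]_((p / 2)%:E)[(fun x =>
          (3^-1 * (cmod (f1 x * f2 x) + cmod (f1 x * f3 x)
                   + cmod (f2 x * f3 x)))%R%:E)] `^ (p / 2))%E
  / (3^-1 * fine (cLnorm mu p f1 `^ p + cLnorm mu p f2 `^ p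
                  + cLnorm mu p f3 `^ p)%E).

Definition beta3 (R : realType) (p : R) : R :=
  2 * ln 2 / ((p - 2) * ln 3 + 2 * ln 2).

Definition conj_exp (R : realType) (p : R) : R := p / (p - 1).

(* Main.v *)
Require Import Defs.
From mathcomp Require Import all_boot all_order all_algebra.
From mathcomp Require Import all_classical all_reals all_analysis.
From mathcomp Require Import measurable_realfun complex ring lra.

Import Order.TTheory GRing.Theory Num.Theory.
Import numFieldNormedType.Exports.

Local Open Scope classical_set_scope.
Local Open Scope ring_scope.

(** Since |f1 + f2 + f3| <= |f1| + |f2| + |f3|, only the moduli matter. For
    nonnegative reals a, b, c put S = a^p + b^p + c^p,
    M = ((ab + ac + bc) / 3)^(p/2) and g(t) = (1 + 2 t^beta)^(p - 1), where beta
    is beta(3, p). The theorem is the integrated form of the pointwise inequality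
    (a + b + c)^p <= g(3 M / S) S ([pointwise_ineq]). Indeed g is concave on
    [0, 1]: the tangent of g at Gamma lies above g ([envelope_tangent]), and
    integrating it against the measure S dmu gives
    int (a + b + c)^p <= g(Gamma) int S, which is Jensen's inequality
    ([integral_ineq]); when Gamma = 0 one lets the point of tangency tend to 0.

    For the pointwise inequality assume a + b + c = 1 by homogeneity, and set
    q = 3 (ab + ac + bc), n = 3 S^(1/(p-1)) and m = (3 - n) / 2. Then
    3 M / S = q^(p/2) / n^(p-1), and what has to be proved is
    m / n <= (q^(p/2) / n^(p-1))^beta. Writing lambda for the binary logarithm
    of 3, 1 / beta = 1 + lambda (p - 2) / 2, so that raising to the power
    1 / beta turns this into the product of m / n <= q / n with the power
    (p - 2) / 2 of
      (m / n)^lambda <= q / n^2.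
    Up to the factor 3, n is exp(- H) for H the Renyi entropy of order p of
    (a, b, c); it increases with p. The exponent p has disappeared from the two
    inequalities except through n, both get weaker as n grows, and p >= 3: it
    is enough to know lower bounds for n at p = 3, where
    n^2 = 9 (a^3 + b^3 + c^3) ([sum_powR_ge_cubes], [sum_cubes_lower_bounds]).
    Then m <= q is the Cauchy-Schwarz inequality, and the second inequality,
    an equality at (1/3, 1/3, 1/3) and (1/2, 1/2, 0), becomes a one-variable
    problem ([ratio_powR_log2_3_le]). *)

Set Implicit Arguments.
Unset Strict Implicit.
Unset Printing Implicit Defensive.

(** * Bernoulli and Jensen inequalities for real powers *)

Lemma powR_le_base (R : realType) (r x y : R) :
  0 <= r -> 0 <= x -> x <= y -> x `^ r <= y `^ r.
Proof.
move=> r0 x0 xy; apply: ge0_ler_powR => //; rewrite nnegrE //.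
exact: le_trans xy.
Qed.

(** Dividing by x, with L = ln x: the claim is the sum of
    e^((k-1)L) >= 1 + (k-1)L and of k-1 times e^(-L) >= 1 - L. *)
Lemma powR_bernoulli (R : realType) (k x : R) :
  1 <= k -> 0 <= x -> 1 + k * (x - 1) <= x `^ k.
Proof.
move=> k1; rewrite le_eqVlt => /predU1P[<-|x0].
  by rewrite powR0 ?sub0r; [lra|rewrite gt_eqF//; lra].
have -> : x `^ k = x * expR ((k - 1) * ln x).
  rewrite /powR gt_eqF// -[X in _ = X * _](lnK x0) -expRD.
  by congr expR; ring.
have h1 := expR_ge1Dx ((k - 1) * ln x).
have h2 := expR_ge1Dx (- ln x).
have h3 : expR (- ln x) = x^-1 by rewrite expRN lnK.
rewrite h3 in h2.
have h5 : x * (1 + - ln x) <= 1.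
  by rewrite -ler_pdivlMl// mulr1.
have h6 : x * (1 + (k - 1) * ln x) <= x * expR ((k - 1) * ln x).
  by rewrite ler_pM2l.
have h7 : 0 <= (k - 1) * (1 - x * (1 - ln x)) by rewrite mulr_ge0// subr_ge0.
lra.
Qed.

(** Bernoulli's inequality for the exponent 1/k, read at the point x^k. *)
Lemma powR_concave_tangent (R : realType) (k x : R) :
  0 < k -> k <= 1 -> 0 <= x -> x `^ k <= 1 + k * (x - 1).
Proof.
move=> k0 k1 x0.
have kV : 1 <= k^-1 by rewrite invf_ge1.
have := powR_bernoulli kV (powR_ge0 x k).
rewrite -powRrM mulfV ?gt_eqF// powRr1// => h.
have : k * (1 + k^-1 * (x `^ k - 1)) <= k * x by rewrite ler_pM2l.
by rewrite mulrDr mulrA mulfV ?gt_eqF//; lra.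
Qed.

(** Each x_i^k is bounded below by the tangent of the power function at the
    weighted mean, and the linear terms average out. *)
Lemma jensen3_powR (R : realType) (k w1 w2 w3 x1 x2 x3 : R) :
  1 <= k -> 0 <= w1 -> 0 <= w2 -> 0 <= w3 -> w1 + w2 + w3 = 1 ->
  0 <= x1 -> 0 <= x2 -> 0 <= x3 ->
  (w1 * x1 + w2 * x2 + w3 * x3) `^ k
    <= w1 * x1 `^ k + w2 * x2 `^ k + w3 * x3 `^ k.
Proof.
move=> k1 w1_0 w2_0 w3_0 ws x1_0 x2_0 x3_0.
set X := w1 * x1 + _ + _.
have : 0 <= X by rewrite /X !addr_ge0// mulr_ge0.
rewrite le_eqVlt => /predU1P[<-|X0].
  rewrite powR0; first by rewrite !addr_ge0// mulr_ge0// powR_ge0.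
  by rewrite gt_eqF//; lra.
have tangent x : 0 <= x -> X `^ k * (1 + k * (x / X - 1)) <= x `^ k.
  move=> x0; rewrite -[X in _ <= X `^ k](divfK (lt0r_neq0 X0)) mulrC.
  rewrite powRM ?divr_ge0 ?(ltW X0)// ler_wpM2r ?powR_ge0//.
  by apply: powR_bernoulli; rewrite ?divr_ge0// ltW.
have e : w1 * (x1 / X) + w2 * (x2 / X) + w3 * (x3 / X) = 1.
  by rewrite !mulrA -!mulrDl mulfV// gt_eqF.
have t1 := ler_wpM2l w1_0 (tangent _ x1_0).
have t2 := ler_wpM2l w2_0 (tangent _ x2_0).
have t3 := ler_wpM2l w3_0 (tangent _ x3_0).
apply: le_trans (lerD (lerD t1 t2) t3).
set Y := X `^ k; set y1 := x1 / X in e *; set y2 := x2 / X in e *.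
set y3 := x3 / X in e *.
rewrite [leRHS](_ : _ = Y * ((w1 + w2 + w3) * (1 - k)
  + k * (w1 * y1 + w2 * y2 + w3 * y3))); last by ring.
by rewrite e ws (_ : 1 * (1 - k) + k * 1 = 1) ?mulr1//; ring.
Qed.

(** * The binary logarithm of 3 *)

Definition log2_3 (R : realType) : R := ln 3 / ln 2.

Lemma ln2_gt0 (R : realType) : 0 < ln 2 :> R.
Proof. by rewrite ln_gt0// ltr1n. Qed.

(** These two bounds are 2^19 < 3^12 and 3^8 < 2^13. *)
Lemma log2_3_bounds (R : realType) :
  19 / 12 < log2_3 R /\ log2_3 R < 13 / 8.
Proof.
have l2 := ln2_gt0 R.
rewrite /log2_3; split.
  rewrite ltr_pdivlMr// mulrAC ltr_pdivrMr//.
  rewrite [X in X < _](_ : _ = ln 2 *+ 19); last by rewrite mulr_natl.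
  rewrite [X in _ < X](_ : _ = ln 3 *+ 12); last by rewrite mulr_natr.
  by rewrite -!lnXn// ltr_ln ?posrE ?exprn_gt0//; lra.
rewrite ltr_pdivrMr// mulrAC ltr_pdivlMr//.
rewrite [X in _ < X](_ : _ = ln 2 *+ 13); last by rewrite mulr_natl.
rewrite [X in X < _](_ : _ = ln 3 *+ 8); last by rewrite mulr_natr.
by rewrite -!lnXn// ltr_ln ?posrE ?exprn_gt0//; lra.
Qed.

Lemma powR2_log2_3 (R : realType) : 2 `^ log2_3 R = 3.
Proof.
by rewrite /powR gt_eqF// /log2_3 mulfVK ?gt_eqF ?ln2_gt0// lnK// posrE.
Qed.

Lemma powR2_2Blog2_3 (R : realType) : 2 `^ (2 - log2_3 R) = 4 / 3.
Proof.
rewrite powRB ?powR2_log2_3; first by rewrite powR_mulrn//; congr (_ / _); ring.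
by apply/implyP => _; rewrite pnatr_eq0.
Qed.

(** * A quadratic bound for a power function *)

Lemma MVT_is_derive (R : realType) (f df : R -> R) (a b : R) : a <= b ->
  (forall x : R, a <= x <= b -> is_derive x 1 f (df x)) ->
  exists2 c : R, a <= c <= b & f b - f a = df c * (b - a).
Proof.
move=> ab dfE; have [||c cab ->] := @MVT_segment R f df a b ab.
- by move=> x; rewrite in_itv/= => /andP[/ltW ax /ltW xb]; apply: dfE; rewrite ax.
- apply: derivable_within_continuous => x; rewrite in_itv/= => xab.
  by have [] := dfE x xab.
- by exists c => //; move: cab; rewrite in_itv.
Qed.

(** Both sides agree at v = 1 and at v = 2. With u the right-hand side and theta
    the exponent, the derivative of ln u - theta ln has the sign of a concave
    quadratic Q with Q(1) > 0. If Q(v) >= 0 then Q >= 0 on [1, v] and the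
    difference has grown from 0; otherwise Q <= 0 on [v, 2] and it has yet to
    fall to 0. *)
Lemma powR_le_quadratic (R : realType) (v : R) : 1 <= v <= 2 ->
  v `^ (2 - log2_3 R) <= (6 + 7 * v - v ^+ 2) / 12.
Proof.
move=> /andP[v1 v2]; set th := 2 - log2_3 R.
have [th1 th2] : 3 / 8 < th /\ th < 5 / 12.
  by have := log2_3_bounds R; rewrite /th; lra.
pose u (x : R) := (6 + 7 * x - x ^+ 2) / 12.
pose du (x : R) := (7 - 2 * x) / 12.
pose f (x : R) := ln (u x) - th * ln x.
pose df (x : R) := (u x)^-1 * du x - th * x^-1.
have u_gt0 x : 1 <= x <= 2 -> 0 < u x by move=> /andP[]; rewrite /u; nra.
have d_f (x : R) : 1 <= x <= 2 -> is_derive x 1 f (df x).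
  move=> x12; have x0 : 0 < x by move/andP: x12; lra.
  have Hu : is_derive x 1 u (du x).
    rewrite /u; apply: is_derive_eq; rewrite /du /GRing.scale/=; lra.
  have Hl := is_derive1_ln x0.
  have Hlu := is_derive1_comp (is_derive1_ln (u_gt0 _ x12)) Hu.
  rewrite /f; apply: is_derive_eq; rewrite /df /GRing.scale/=; ring.
have f1 : f 1 = 0.
  by rewrite /f /u ln1 mulr0 subr0 (_ : _ / _ = 1) ?ln1//; lra.
have f2 : f 2 = 0.
  rewrite /f -ln_powR powR2_2Blog2_3 /u (_ : _ / 12 = 4 / 3) ?subrr//; lra.
have v0 : 0 < v by lra.
pose Q (x : R) := - 6 * th + 7 * (1 - th) * x - (2 - th) * x ^+ 2.
have dfE x : 1 <= x <= 2 -> df x = Q x / (12 * x * u x).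
  move=> x12; have ux := u_gt0 _ x12; have x0 : 0 < x by move/andP: x12; lra.
  have ux' := ux; rewrite /u pmulr_lgt0// in ux'.
  rewrite /df /du /Q /u; field.
  by rewrite !gt_eqF.
have den_gt0 x : 1 <= x <= 2 -> 0 < 12 * x * u x.
  move=> x12; rewrite mulr_gt0 ?u_gt0//; move/andP: x12; lra.
have Q1 : 0 < Q 1 by rewrite /Q; lra.
(* Lagrange interpolation of the concave quadratic at 1 and y. *)
have Q_interp x y : Q x * (y - 1) = Q 1 * (y - x) + Q y * (x - 1)
    + (2 - th) * ((y - 1) * ((y - x) * (x - 1))).
  by rewrite /Q; ring.
have f_ge0 : 0 <= f v.
  have [Qv|Qv] := leP 0 (Q v).
    have [x|x /andP[x1 xv]] := @MVT_is_derive _ f df 1 v v1.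
      by move=> /andP[x1 xv]; apply: d_f; rewrite x1 (le_trans xv).
    rewrite f1 subr0 => ->.
    have x12 : 1 <= x <= 2 by rewrite x1 (le_trans xv).
    rewrite dfE// mulrAC divr_ge0 ?(ltW (den_gt0 _ _))// Q_interp.
    by rewrite !addr_ge0 ?mulr_ge0 ?(ltW Q1)//; lra.
  have [x|x /andP[vx x2]] := @MVT_is_derive _ f df v 2 v2.
    by move=> /andP[vx x2]; apply: d_f; rewrite x2 (le_trans v1).
  have v_gt1 : 1 < v.
    by rewrite lt_neqAle v1 andbT; apply: contraTneq Qv => <-; rewrite -leNgt ltW.
  have Qx : Q x <= 0.
    have h : 0 <= Q 1 * (x - v) + (2 - th) * ((x - 1) * ((x - v) * (v - 1))).
      by rewrite addr_ge0 ?mulr_ge0 ?(ltW Q1)//; lra.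
    have h' := Q_interp v x.
    have h'' : Q v * (x - 1) <= 0 by rewrite mulr_le0_ge0 ?(ltW Qv)//; lra.
    have : Q x * (v - 1) <= 0 by lra.
    by rewrite pmulr_lle0// subr_gt0.
  rewrite f2 sub0r => /(canRL (@opprK _)) ->.
  have x12 : 1 <= x <= 2 by rewrite x2 (le_trans v1).
  rewrite oppr_ge0 mulr_le0_ge0 ?subr_ge0// dfE//.
  by rewrite mulr_le0_ge0// invr_ge0 ltW// den_gt0.
rewrite -ler_ln ?posrE ?powR_gt0// ?u_gt0 ?v1//.
by rewrite ln_powR; move: f_ge0; rewrite /f subr_ge0.
Qed.

(** * The pointwise inequality *)

(** With v = 2n / (3 - n) the claim reads 9 v^theta <= q (2 + v)^2, where
    theta = 2 - log2 3. For v >= 2 the bound q >= 1 - n^2/9 turns the right-hand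
    side into at least 4 + 4v, which dominates the tangent of 9 v^theta at v = 2.
    For v in [1, 2] the second bound on q applies; replacing v^theta by the
    quadratic u of [powR_le_quadratic] leaves a polynomial inequality with the
    factor (v - 1) (2 - v). *)
Lemma ratio_powR_log2_3_le (R : realType) (q n : R) :
  0 <= q -> 1 <= n -> n < 3 ->
  9 * (1 - q) <= n ^+ 2 -> 9 - 2 * n ^+ 2 <= 4 * q ^+ 2 + 3 * q ->
  ((3 - n) / 2 / n) `^ log2_3 R <= q / n ^+ 2.
Proof.
move=> q0 n1 n3 hlow hhigh.
have n0 : 0 < n by lra.
set v := 2 * n / (3 - n).
have vE : v * (3 - n) = 2 * n by rewrite divfK// gt_eqF// subr_gt0.
have v0 : 0 < v by rewrite divr_gt0//; lra.
have nv : n * (2 + v) = 3 * v by lra.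
have -> : (3 - n) / 2 / n = v^-1.
  by rewrite /v; field; rewrite !gt_eqF//; lra.
clearbody v.
set th := 2 - log2_3 R.
have [th1 th2] : 3 / 8 < th /\ th < 5 / 12.
  by have := log2_3_bounds R; rewrite /th; lra.
set D := (2 + v) ^+ 2.
have D0 : 0 < D by rewrite exprn_gt0//; lra.
have nD : n ^+ 2 * D = 9 * v ^+ 2 by rewrite -exprMn nv; ring.
suff main : 9 * v `^ th <= q * D.
  have -> : v^-1 `^ log2_3 R = v `^ th / v ^+ 2.
    rewrite -(powR_mulrn 2 (ltW v0)) -powRB; last first.
      by rewrite (gt_eqF v0) implybT.
    by rewrite -powR_inv1 ?ltW// -powRrM; congr (_ `^ _); rewrite /th; ring.
  rewrite ler_pdivlMr ?exprn_gt0// mulrAC ler_pdivrMr ?exprn_gt0//.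
  rewrite -(ler_pM2r D0).
  rewrite [leLHS](_ : _ = v `^ th * (n ^+ 2 * D)); last by ring.
  rewrite nD [leLHS](_ : _ = v ^+ 2 * (9 * v `^ th)); last by ring.
  rewrite [leRHS](_ : _ = v ^+ 2 * (q * D)); last by ring.
  by rewrite ler_pM2l// exprn_gt0.
have [v2|v2] := leP 2 v.
  have vth : v `^ th <= 4 / 3 * (1 + th * (v / 2 - 1)).
    rewrite -{1}(@divfK _ 2 _ v)// powRM ?divr_ge0 ?(ltW v0)//.
    rewrite (powR2_2Blog2_3 R : 2 `^ th = _) mulrC.
    rewrite ler_pM2l; last by lra.
    by apply: powR_concave_tangent; lra.
  have h1 : 9 * (1 - q) * D <= 9 * v ^+ 2 by rewrite -nD ler_pM2r.
  have h2 : 0 <= (2 / 3 - th) * (v - 2) by rewrite mulr_ge0//; lra.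
  have : D = 4 + 4 * v + v ^+ 2 by rewrite /D; ring.
  lra.
have v1 : 1 <= v.
  have : 2 + v <= n * (2 + v) by rewrite ler_peMl//; lra.
  lra.
set u := (6 + 7 * v - v ^+ 2) / 12.
have hu : v `^ th <= u by apply: powR_le_quadratic; rewrite v1 (ltW v2).
(* 4 q^2 + 3 q increases with q, so q < 9 u / D would contradict the lower bound
   on 4 q^2 + 3 q. *)
rewrite leNgt; apply/negP => qD.
set W := v `^ th in hu qD *.
have qDu : q * D < 9 * u by lra.
have qD0 : 0 <= q * D by rewrite mulr_ge0// ltW.
have h1 : (9 - 2 * n ^+ 2) * D ^+ 2 <= (4 * q ^+ 2 + 3 * q) * D ^+ 2.
  by rewrite ler_pM2r// exprn_gt0.
have h2 : (q * D) ^+ 2 <= (9 * u) ^+ 2.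
  by rewrite ler_sqr ?nnegrE//; lra.
have h3 : q * D * D < 9 * u * D by rewrite ltr_pM2r.
have h4 : (9 - 2 * n ^+ 2) * D ^+ 2 = 9 * D ^+ 2 - 2 * (9 * v ^+ 2) * D.
  by rewrite -nD; ring.
have h5 : 9 * D ^+ 2 - 2 * (9 * v ^+ 2) * D - (4 * (9 * u) ^+ 2 + 3 * (9 * u * D))
    = 9 / 4 * ((v - 1) * (2 - v) * (4 * v ^+ 2 + v - 2)).
  by rewrite /D /u; field.
have h6 : 0 <= (v - 1) * (2 - v) * (4 * v ^+ 2 + v - 2).
  by rewrite !mulr_ge0//; nra.
lra.
Qed.

Lemma beta3E (R : realType) (p : R) : 2 <= p ->
  beta3 p = 2 / ((p - 2) * log2_3 R + 2).
Proof.
move=> p2; have l2 := ln2_gt0 R.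
have l3 : 0 < ln 3 :> R by rewrite ln_gt0// ltr1n.
have den : 0 < (p - 2) * ln 3 + 2 * ln 2.
  by rewrite ltr_wpDl ?mulr_ge0 ?mulr_gt0 ?(ltW l3)// subr_ge0.
by rewrite /beta3 /log2_3; field; rewrite !gt_eqF.
Qed.

(** Jensen's inequality with weights a, b, c at the points a^2, b^2, c^2: the
    Renyi entropies decrease in their order, here from 3 to p. *)
Lemma sum_powR_ge_cubes (R : realType) (p a b c : R) : 3 <= p ->
  0 <= a -> 0 <= b -> 0 <= c -> a + b + c = 1 ->
  (a ^+ 3 + b ^+ 3 + c ^+ 3) `^ ((p - 1) / 2) <= a `^ p + b `^ p + c `^ p.
Proof.
move=> p3 a0 b0 c0 abc.
have e x : 0 <= x -> x * (x ^+ 2) `^ ((p - 1) / 2) = x `^ p.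
  move=> x0; rewrite -(powR_mulrn 2 x0) -powRrM mulrCA mulfV// mulr1.
  by rewrite mulr_powRB1//; lra.
rewrite -!e// !(exprS _ 2); apply: jensen3_powR; rewrite ?sqr_ge0//; lra.
Qed.

(** The four bounds come from, respectively: convexity of the cube, the
    Cauchy-Schwarz inequality, abc >= 0, and Schur's inequality of degree 4. *)
Lemma sum_cubes_lower_bounds (R : realType) (a b c : R) :
  0 <= a -> 0 <= b -> 0 <= c -> a + b + c = 1 ->
  let e := a * b + a * c + b * c in
  let T := a ^+ 3 + b ^+ 3 + c ^+ 3 in
  [/\ 1 / 9 <= T, (1 - 2 * e) ^+ 2 <= T, 1 - 3 * e <= T
     & 1 - 5 * e + 4 * e ^+ 2 + 2 * (T - 1 + 3 * e) >= 0].
Proof.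
move=> a0 b0 c0 abc e T.
have cE : c = 1 - a - b by lra.
have w0 : 0 <= a * b * c by rewrite !mulr_ge0.
have TE : T = 1 - 3 * e + 3 * (a * b * c) by rewrite /T /e cE; ring.
split; last 2 first.
- by lra.
- rewrite TE [leRHS](_ : _ = ((b - c) ^+ 2 * (b + c - a) ^+ 2
    + (a - c) ^+ 2 * (a + c - b) ^+ 2
    + (a - b) ^+ 2 * (a + b - c) ^+ 2) / 2).
    rewrite divr_ge0//.
    by do ?[exact: sqr_ge0|apply: addr_ge0|apply: mulr_ge0].
  by rewrite /e cE; field.
- have tangent (x : R) : 0 <= x -> x / 3 - 2 / 27 <= x ^+ 3.
    move=> x0; rewrite -subr_ge0.
    rewrite [leRHS](_ : _ = (x - 1 / 3) ^+ 2 * (x + 2 / 3)); last by field.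
    by rewrite mulr_ge0 ?sqr_ge0//; lra.
  have := tangent a a0; have := tangent b b0; have := tangent c c0.
  by rewrite /T; lra.
- rewrite -subr_ge0 [leRHS](_ : _ =
    a * b * (a - b) ^+ 2 + a * c * (a - c) ^+ 2 + b * c * (b - c) ^+ 2).
    by do ?[exact: sqr_ge0|assumption|apply: addr_ge0|apply: mulr_ge0].
  by rewrite /T /e cE; ring.
Qed.

(** With q, n and m as above, the claim is 3 <= n (1 + 2 gam^beta), that is
    m / n <= gam^beta, where gam = q^(p/2) / n^(p-1). The bounds on the sum of
    cubes give m <= q and (m / n)^lambda <= q / n^2, and 1 / beta is the exponent
    that combines them into gam. *)
Lemma normalized_pointwise_ineq (R : realType) (p a b c : R) : 3 <= p ->
  0 <= a -> 0 <= b -> 0 <= c -> a + b + c = 1 ->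
  1 <= (1 + 2 * (3 * (3^-1 * (a * b + a * c + b * c)) `^ (p / 2)
                 / (a `^ p + b `^ p + c `^ p)) `^ beta3 p) `^ (p - 1)
       * (a `^ p + b `^ p + c `^ p).
Proof.
move=> p3 a0 b0 c0 abc; set S := a `^ p + b `^ p + c `^ p.
set e := a * b + a * c + b * c.
set T := a ^+ 3 + b ^+ 3 + c ^+ 3.
have TS : T `^ ((p - 1) / 2) <= S by apply: sum_powR_ge_cubes.
pose q := 3 * e.
have [T19 T_CS T_abc T_schur] := sum_cubes_lower_bounds a0 b0 c0 abc.
rewrite -/e -/T in T_CS T_abc T_schur T19.
have e0 : 0 <= e by rewrite !addr_ge0// mulr_ge0.
have T0 : 0 < T by lra.
have Thalf0 : 0 < T `^ ((p - 1) / 2) by rewrite powR_gt0.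
have S0 : 0 < S by lra.
pose n := 3 * S `^ (p - 1)^-1.
have n0 : 0 < n by rewrite mulr_gt0// powR_gt0.
have p1 : p - 1 != 0 by rewrite gt_eqF//; lra.
have nS : S = (n / 3) `^ (p - 1).
  rewrite /n mulrAC mulfV ?mul1r// -powRrM mulVf// powRr1// ltW//.
have nT : 9 * T <= n ^+ 2.
  rewrite /n exprMn -[X in _ <= _ * X]powR_mulrn ?powR_ge0// -powRrM.
  rewrite (_ : 3 ^+ 2 = 9); last by ring.
  rewrite ler_pM2l//.
  rewrite -[leLHS]powRr1 ?(ltW T0)//.
  rewrite [X in T `^ X](_ : 1 = (p - 1) / 2 * ((p - 1)^-1 * 2)); last by field.
  rewrite [leLHS]powRrM; apply: powR_le_base => //; last exact: ltW.
  by rewrite mulr_ge0// invr_ge0; lra.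
have n1 : 1 <= n.
  by rewrite -(@ler_sqr _ 1 n) ?nnegrE ?(ltW n0)// expr1n; lra.
have nq : 3 - 2 * q <= n.
  have [?|?] := leP (3 - 2 * q) 0; first by rewrite (le_trans _ (ltW n0)).
  rewrite -ler_sqr ?nnegrE ?(ltW n0)//; last by apply: ltW.
  apply: le_trans nT; apply: le_trans (_ : 9 * (1 - 2 * e) ^+ 2 <= _).
    by rewrite /q; lra.
  by rewrite ler_pM2l.
set gam := 3 * _ / _.
have gamE : gam = q `^ (p / 2) / n `^ (p - 1).
  rewrite /gam (_ : 3^-1 * e = q * 3^-1 ^+ 2); last by rewrite /q; field.
  have t0 : 0 <= 3^-1 :> R by rewrite invr_ge0.
  rewrite nS powRM ?mulr_ge0// ?exprn_ge0// powRM ?(ltW n0)//.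
  rewrite -(powR_mulrn 2 t0) -powRrM (_ : 2 * (p / 2) = p); last by field.
  rewrite -(@mulr_powRB1 _ 3^-1 p)//; last by lra.
  by field; rewrite !gt_eqF// powR_gt0// invr_gt0.
have gam0 : 0 <= gam by rewrite gamE divr_ge0 ?powR_ge0.
suff key : 3 <= n * (1 + 2 * gam `^ beta3 p).
  rewrite nS -powRM; last 2 first.
  - by rewrite addr_ge0// mulr_ge0// powR_ge0.
  - by rewrite divr_ge0// ltW.
  rewrite -[leLHS](_ : 1 `^ (p - 1) = 1); last by rewrite powR1.
  by apply: powR_le_base => //; lra.
(* For n >= 3 the factor 1 + 2 gam^beta >= 1 already suffices. *)
have [n3|n3] := leP 3 n.
  rewrite -[leLHS]mulr1 ler_pM//.
  by rewrite lerDl mulr_ge0// powR_ge0.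
pose m := (3 - n) / 2.
suff : m / n <= gam `^ beta3 p.
  by rewrite ler_pdivrMr// /m; lra.
have m0 : 0 < m by rewrite /m; lra.
have mn0 : 0 < m / n by apply: divr_gt0.
have mq : m <= q by rewrite /m; lra.
have q0 : 0 < q by lra.
have K2 : (m / n) `^ log2_3 R <= q / n ^+ 2.
  apply: ratio_powR_log2_3_le => //; first exact: ltW.
    by rewrite /q; lra.
  by rewrite /q; lra.
have lam := log2_3_bounds R.
have lam0 : 0 < (p - 2) * log2_3 R + 2.
  by rewrite addr_gt0// mulr_gt0//; lra.
rewrite beta3E; last by lra.
rewrite -[leLHS](powRr1 (ltW mn0)).
rewrite [X in (m / n) `^ X](_ : 1 = ((p - 2) * log2_3 R / 2 + 1) * (2 / ((p - 2) * log2_3 R + 2))); last first.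
  by field; rewrite gt_eqF.
rewrite [leLHS]powRrM.
apply: powR_le_base; [by rewrite divr_ge0 ?(ltW lam0)|exact: powR_ge0|].
have qn0 : 0 < q / n ^+ 2 by rewrite divr_gt0// exprn_gt0.
(* After raising to the power 1 / beta, gam splits into one factor for each of
   the inequalities m <= q and K2. *)
have -> : gam = (q / n ^+ 2) `^ ((p - 2) / 2) * (q / n).
  have -> : q / n = q / n ^+ 2 * n by field; rewrite gt_eqF.
  rewrite mulrA [X in X * n]mulrC [X in _ `^ X](_ : _ = p / 2 - 1); last by field.
  rewrite mulr_powRB1 ?(ltW qn0)//; last by lra.
  rewrite powRM ?invr_ge0 ?exprn_ge0 ?(ltW q0) ?(ltW n0)// gamE -mulrA; congr (_ * _).
  rewrite -(powR_mulrn 2 (ltW n0)) -!powRN -powRrM.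
  rewrite -[X in _ * X](powRr1 (ltW n0)) -powRD ?(gt_eqF n0) ?implybT//.
  by congr (_ `^ _); field.
rewrite powRD ?(gt_eqF mn0) ?implybT// powRr1 ?(ltW mn0)//.
rewrite [X in (m / n) `^ X](_ : _ = log2_3 R * ((p - 2) / 2)); last by field.
rewrite powRrM ler_pM ?powR_ge0 ?(ltW mn0)//.
  by apply: powR_le_base => //; [lra|exact: powR_ge0].
by rewrite ler_pM2r ?invr_gt0.
Qed.

Definition envelope (R : realType) (p t : R) : R :=
  (1 + 2 * t `^ beta3 p) `^ (p - 1).

Definition pair_mean (R : realType) (p a b c : R) : R :=
  (3^-1 * (a * b + a * c + b * c)) `^ (p / 2).

(** ab + ac + bc <= a^2 + b^2 + c^2, followed by the power mean inequality. *)
Lemma pair_mean_le (R : realType) (p a b c : R) : 2 <= p ->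
  0 <= a -> 0 <= b -> 0 <= c ->
  3 * pair_mean p a b c <= a `^ p + b `^ p + c `^ p.
Proof.
move=> p2 a0 b0 c0.
have e (x : R) : 0 <= x -> (x ^+ 2) `^ (p / 2) = x `^ p.
  by move=> x0; rewrite -(powR_mulrn 2 x0) -powRrM; congr (_ `^ _); field.
rewrite -ler_pdivlMl// !mulrDr.
apply: (@le_trans _ _ ((3^-1 * a ^+ 2 + 3^-1 * b ^+ 2 + 3^-1 * c ^+ 2) `^ (p / 2))).
  apply: powR_le_base; first by lra.
    by rewrite mulr_ge0 ?invr_ge0// !addr_ge0// mulr_ge0.
  rewrite -!mulrDr ler_pM2l ?invr_gt0// -subr_ge0.
  rewrite [leRHS](_ : _ = ((a - b) ^+ 2 + (a - c) ^+ 2 + (b - c) ^+ 2) / 2).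
    by rewrite divr_ge0// !addr_ge0// sqr_ge0.
  by field.
rewrite -!e//; apply: jensen3_powR; rewrite ?sqr_ge0 ?invr_ge0//; lra.
Qed.

(** Both sides are homogeneous of degree p, and the argument of the envelope is
    homogeneous of degree 0. *)
Lemma pointwise_ineq (R : realType) (p a b c : R) : 3 <= p ->
  0 <= a -> 0 <= b -> 0 <= c ->
  (a + b + c) `^ p
    <= envelope p (3 * pair_mean p a b c / (a `^ p + b `^ p + c `^ p))
       * (a `^ p + b `^ p + c `^ p).
Proof.
move=> p3 a0 b0 c0.
have p0 : 0 < p by lra.
have : 0 <= a + b + c by rewrite !addr_ge0.
rewrite le_eqVlt => /predU1P[<-|s0].
  by rewrite powR0 ?(gt_eqF p0)// mulr_ge0 ?powR_ge0// !addr_ge0// powR_ge0.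
set s := a + b + c in s0 *.
have div0 (x : R) : 0 <= x -> 0 <= x / s by move=> x0; rewrite divr_ge0 ?(ltW s0).
have sum1 : a / s + b / s + c / s = 1 by rewrite -!mulrDl mulfV// gt_eqF.
have := normalized_pointwise_ineq p3 (div0 _ a0) (div0 _ b0) (div0 _ c0) sum1.
have scale (x : R) : 0 <= x -> (x / s) `^ p = x `^ p / s `^ p.
  move=> x0; rewrite powRM ?invr_ge0 ?(ltW s0)//; congr (_ * _).
  by rewrite -(powR_inv1 (ltW s0)) -powRrM mulN1r powRN.
have sp0 : 0 < s `^ p by rewrite powR_gt0.
rewrite !scale// -!mulrDl.
rewrite (_ : 3^-1 * _ = 3^-1 * (a * b + a * c + b * c) * s^-1 ^+ 2); last first.
  by field; rewrite gt_eqF.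
have -> : (3^-1 * (a * b + a * c + b * c) * s^-1 ^+ 2) `^ (p / 2)
    = pair_mean p a b c / s `^ p.
  have si0 : 0 <= s^-1 by rewrite invr_ge0 ltW.
  rewrite powRM ?sqr_ge0//; last first.
    by rewrite mulr_ge0 ?invr_ge0// !addr_ge0// mulr_ge0.
  rewrite -(powR_mulrn 2 si0) -powRrM (_ : 2 * (p / 2) = p); last by field.
  by rewrite -(powR_inv1 (ltW s0)) -(powRrM s) mulN1r powRN.
set S := a `^ p + _ + _.
rewrite (_ : 3 * _ / _ = 3 * pair_mean p a b c / S).
  by rewrite mulrA ler_pdivlMr// mul1r.
have : 0 <= S by rewrite !addr_ge0// powR_ge0.
rewrite le_eqVlt => /predU1P[<-|S0]; last by field; rewrite !gt_eqF.
by rewrite mul0r !invr0 !mulr0.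
Qed.

(** * Concavity of the envelope *)

Lemma beta3_gt0 (R : realType) (p : R) : 2 <= p -> 0 < beta3 p.
Proof.
move=> p2; have lam := log2_3_bounds R.
rewrite beta3E// divr_gt0// ltr_wpDl// mulr_ge0//; lra.
Qed.

(** The two conditions under which the derivative of the envelope, written as in
    [envelope_tangent], meets the hypotheses of [envelope_slope_antitone]; they
    follow from 4/3 <= log2 3 <= 2. *)
Lemma beta3_bounds (R : realType) (p : R) : 2 <= p ->
  1 <= beta3 p * (p - 1) /\ beta3 p * (2 * p - 1) <= 3.
Proof.
move=> p2; have [lam1 lam2] := log2_3_bounds R.
have d0 : 0 < (p - 2) * log2_3 R + 2 by rewrite ltr_wpDl// mulr_ge0//; lra.
rewrite beta3E// mulrAC ler_pdivlMr// mul1r mulrAC ler_pdivrMr//.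
have h1 : 0 <= (p - 2) * (2 - log2_3 R) by rewrite mulr_ge0//; lra.
have h2 : 0 <= (p - 2) * (log2_3 R - 4 / 3) by rewrite mulr_ge0//; lra.
by split; lra.
Qed.

(** With L = ln (s/t) <= 0, the case t = 1, applied to the ratio s/t, is
    e^(-dL) + 2 e^(eL) >= 3 + (2e - d) L >= 3. For t < 1 the decreasing summand
    is scaled up by t^(-d) >= 1 and the increasing one down by t^e <= 1. *)
Lemma envelope_slope_antitone (R : realType) (d e s t : R) :
  0 <= e -> 2 * e <= d -> 0 < s -> s <= t -> t <= 1 ->
  t `^ (- d) + 2 * t `^ e <= s `^ (- d) + 2 * s `^ e.
Proof.
move=> e0 ed s0 st t1.
have t0 : 0 < t by lra.
have d0 : 0 <= d by lra.
set L := ln (s / t).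
have r0 : 0 < s / t by rewrite divr_gt0.
have L0 : L <= 0 by rewrite -ln1 ler_ln ?posrE// ler_pdivrMr// mul1r.
have sE x : s `^ x = t `^ x * expR (x * L).
  rewrite -{1}(@divfK _ t _ s) ?gt_eqF// powRM ?(ltW r0) ?(ltW t0)// mulrC.
  by congr (_ * _); rewrite /powR gt_eqF.
rewrite !sE.
have A1 : 1 <= t `^ (- d).
  by rewrite powRN invf_ge1 ?powR_gt0// -(powRr0 t) ger_powR// t0.
have B1 : t `^ e <= 1 by rewrite -(powRr0 t) ger_powR// t0.
have B0 : 0 <= t `^ e by apply: powR_ge0.
have x1 := expR_ge1Dx (- d * L).
have x2 := expR_ge1Dx (e * L).
have x3 : 0 <= (2 * e - d) * L by rewrite mulr_le0//; lra.
have dL : d * L <= 0 by rewrite mulr_ge0_le0.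
have x4 : expR (e * L) <= 1 by rewrite -(expR0 R) ler_expR mulr_ge0_le0.
set A := t `^ (- d) in A1 *; set B := t `^ e in B1 B0 *.
set X := expR (- d * L) in x1 *; set Y := expR (e * L) in x2 x4 *.
have h1 : 0 <= (A - 1) * (X - 1) by rewrite mulr_ge0//; lra.
have h2 : 0 <= (1 - B) * (1 - Y) by rewrite mulr_ge0//; lra.
lra.
Qed.

Lemma antitone_derivative_tangent (R : realType) (f df : R -> R) (G t : R) :
  (forall x : R, 0 < x -> is_derive x 1 f (df x)) ->
  (forall x y : R, 0 < x -> x <= y -> y <= 1 -> df y <= df x) ->
  0 < G -> G <= 1 -> 0 < t -> t <= 1 -> f t <= f G + df G * (t - G).
Proof.
move=> dfE df_anti G0 G1 t0 t1; have [tG|/ltW Gt] := leP t G.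
  have [x|x /andP[tx xG]] := @MVT_is_derive _ f df t G tG.
    by move=> /andP[tx _]; apply: dfE; exact: lt_le_trans tx.
  have := df_anti x G (lt_le_trans t0 tx) xG G1.
  rewrite -subr_ge0 => h1 h2.
  have : 0 <= (df x - df G) * (G - t) by rewrite mulr_ge0// subr_ge0.
  lra.
have [x|x /andP[Gx xt]] := @MVT_is_derive _ f df G t Gt.
  by move=> /andP[Gx _]; apply: dfE; exact: lt_le_trans Gx.
have := df_anti G x G0 Gx (le_trans xt t1).
rewrite -subr_ge0 => h1 h2.
have : 0 <= (df G - df x) * (t - G) by rewrite mulr_ge0// subr_ge0.
lra.
Qed.

(** The derivative of the envelope is a constant times the power p - 2 of
    t^(-d) + 2 t^(beta - d), where d (p - 2) = 1 - beta; hence it decreases on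
    (0, 1]. The envelope need not be differentiable at t = 0; there the bound is
    obtained as a limit. *)
Lemma envelope_tangent (R : realType) (p G : R) : 3 <= p -> 0 < G -> G <= 1 ->
  exists2 D : R, 0 <= D &
    forall t : R, 0 <= t -> t <= 1 -> envelope p t <= envelope p G + D * (t - G).
Proof.
move=> p3 G0 G1.
have b0 : 0 < beta3 p by apply: beta3_gt0; lra.
have [b1 b2] : 1 <= beta3 p * (p - 1) /\ beta3 p * (2 * p - 1) <= 3.
  by apply: beta3_bounds; lra.
set b := beta3 p in b0 b1 b2 *.
pose d := (1 - b) / (p - 2).
have dE : d * (p - 2) = 1 - b by rewrite /d divfK// gt_eqF//; lra.
pose k (t : R) := t `^ (- d) + 2 * t `^ (b - d).
pose dg (t : R) := 2 * b * (p - 1) * k t `^ (p - 2).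
have k_ge0 t : 0 <= k t by rewrite addr_ge0 ?mulr_ge0 ?powR_ge0.
have c0 : 0 <= 2 * b * (p - 1).
  by apply: mulr_ge0; [exact: mulr_ge0 (ltW b0)|lra].
have dg_ge0 t : 0 <= dg t.
  exact: mulr_ge0 c0 (powR_ge0 _ _).
have dg_anti (s t : R) : 0 < s -> s <= t -> t <= 1 -> dg t <= dg s.
  move=> s0 st t1; apply: (ler_wpM2l c0).
  apply: powR_le_base => //; first by lra.
  apply: envelope_slope_antitone => //.
    have : 0 <= (b - d) * (p - 2) by lra.
    by rewrite pmulr_lge0//; lra.
  have : 0 <= (d - 2 * (b - d)) * (p - 2) by lra.
  by rewrite pmulr_lge0//; lra.
have dgE (t : R) : 0 < t -> is_derive t 1 (envelope p) (dg t).
  move=> t0.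
  have hb := is_derive1_powR b t0.
  have hin : is_derive t 1 (fun x : R => 1 + 2 * x `^ b) (2 * (b * t `^ (b - 1))).
    by apply: is_derive_eq; rewrite /GRing.scale/=; ring.
  have in0 : 0 < 1 + 2 * t `^ b.
    by rewrite ltr_wpDr// mulr_ge0// powR_ge0.
  have hout := is_derive1_powR (p - 1) in0.
  have := @is_derive1_comp _ (powR (R:=R) ^~ (p - 1)) (fun x => 1 + 2 * x `^ b)
    _ _ _ hout hin.
  rewrite (_ : _ * _ = dg t)//.
  have kE : k t = t `^ (- d) * (1 + 2 * t `^ b).
    rewrite mulrDr mulr1 mulrCA -powRD ?(gt_eqF t0) ?implybT//.
    by rewrite (addrC (- d)).
  rewrite /dg kE powRM ?powR_ge0 ?(ltW in0)// -powRrM mulNr dE opprB.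
  rewrite (_ : p - 1 - 1 = p - 2); last by ring.
  ring.
have tangent_pos := antitone_derivative_tangent dgE dg_anti G0 G1.
clearbody dg.
exists (dg G) => // t; rewrite le_eqVlt => /predU1P[<-|]; last exact: tangent_pos.
move=> _; rewrite {1}/envelope powR0 ?(gt_eqF b0)// mulr0 addr0 powR1.
apply/ler_addgt0Pr => eps eps0.
(* The envelope is at least 1, its value at 0, and the tangent line at u differs
   by at most eps from the tangent line at 0. *)
pose u := Num.min 1 (eps / (dg G + 1)).
have D1 : 0 < dg G + 1 by rewrite ltr_wpDl.
have u0 : 0 < u by rewrite lt_min ltr01 divr_gt0.
have u1 : u <= 1 by rewrite ge_min lexx.
have ue : u * (dg G + 1) <= eps by rewrite -ler_pdivlMr// ge_min lexx orbT.
have := tangent_pos u u0 u1.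
have : 1 <= envelope p u; last first.
  by move: (envelope p u) (envelope p G) => x y; lra.
rewrite -[leLHS](_ : 1 `^ (p - 1) = 1); last by rewrite powR1.
by apply: powR_le_base => //; [lra|rewrite lerDl mulr_ge0// powR_ge0].
Qed.

(** Convexity of y^(p-1) between y = 1 and y = 3; this quantifies the continuity
    of the envelope at 0. *)
Lemma envelope_le_chord (R : realType) (p t : R) : 3 <= p -> 0 <= t -> t <= 1 ->
  envelope p t <= 1 + t `^ beta3 p * 3 `^ (p - 1).
Proof.
move=> p3 t0 t1; set s := t `^ _.
have s0 : 0 <= s by apply: powR_ge0.
have s1 : s <= 1.
  rewrite -[leRHS](_ : 1 `^ beta3 p = 1); last by rewrite powR1.
  by apply: powR_le_base => //; apply/ltW/beta3_gt0; lra.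
have := @jensen3_powR _ (p - 1) (1 - s) s 0 1 3 0.
rewrite !(mul0r, mulr1, addr0) powR1 mulr1 (_ : 1 - s + s * 3 = 1 + 2 * s); last by ring.
rewrite /envelope -/s => h.
apply: le_trans (h _ _ _ _ _ _ _ _) _ => //; lra.
Qed.

Lemma envelope_base_ge0 (R : realType) (p t : R) : 0 <= 1 + 2 * t `^ beta3 p.
Proof. by rewrite addr_ge0// mulr_ge0// powR_ge0. Qed.

Lemma envelope0 (R : realType) (p : R) : 2 <= p -> envelope p 0 = 1.
Proof.
move=> p2; rewrite /envelope powR0 ?(gt_eqF (beta3_gt0 p2))//.
by rewrite mulr0 addr0 powR1.
Qed.

(** * Integration *)

(** The pointwise hypothesis is h <= A S + (D M - B S), where the bracket has a
    nonpositive integral; the negative term stands on the left so that all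
    integrands are nonnegative. *)
Lemma integral_le_affine_majorant d (T : measurableType d) (R : realType)
    (mu : {measure set T -> \bar R}) (h S M : T -> R) (A B D : R) :
  measurable_fun setT h -> measurable_fun setT S -> measurable_fun setT M ->
  (forall x, 0 <= h x) -> (forall x, 0 <= S x) -> (forall x, 0 <= M x) ->
  0 <= A -> 0 <= B -> 0 <= D ->
  (forall x, h x + B * S x <= A * S x + D * M x) ->
  (\int[mu]_x (S x)%:E < +oo)%E ->
  (D%:E * \int[mu]_x (M x)%:E <= B%:E * \int[mu]_x (S x)%:E)%E ->
  (\int[mu]_x (h x)%:E <= A%:E * \int[mu]_x (S x)%:E)%E.
Proof.
move=> mh mS mM h0 S0 M0 A0 B0 D0 hle Sfin DM.
have intD (f g : T -> R) : measurable_fun setT f -> measurable_fun setT g ->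
    (forall x, 0 <= f x) -> (forall x, 0 <= g x) ->
    (\int[mu]_x (f x + g x)%R%:E = \int[mu]_x (f x)%:E + \int[mu]_x (g x)%:E)%E.
  move=> mf mg f0 g0.
  under eq_integral do rewrite EFinD.
  apply: ge0_integralD => //; try by move=> x _; rewrite lee_fin.
    exact/measurable_EFinP.
  exact/measurable_EFinP.
have intZ (k : R) (f : T -> R) : 0 <= k -> measurable_fun setT f ->
    (forall x, 0 <= f x) ->
    (\int[mu]_x (k * f x)%R%:E = k%:E * \int[mu]_x (f x)%:E)%E.
  move=> k0 mf f0.
  under eq_integral do rewrite EFinM.
  apply: ge0_integralZl_EFin => //; first by move=> x _; rewrite lee_fin.
  exact/measurable_EFinP.
have mZ (k : R) (f : T -> R) : measurable_fun setT f ->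
    measurable_fun setT (fun x => k * f x).
  by move=> mf; apply: measurable_funM => //; exact: measurable_cst.
have S_ge0 : (0 <= \int[mu]_x (S x)%:E)%E.
  by apply: integral_ge0 => x _; rewrite lee_fin.
have BS_fin : (B%:E * \int[mu]_x (S x)%:E)%E \is a fin_num.
  by rewrite fin_numM// ge0_fin_numE.
rewrite -(leeD2rE _ _ BS_fin).
apply: (@le_trans _ _ (A%:E * \int[mu]_x (S x)%:E + D%:E * \int[mu]_x (M x)%:E)%E).
  rewrite -!intZ// -!intD//; try by [exact: mZ|move=> x; rewrite mulr_ge0].
  apply: ge0_le_integral => //.
  - by move=> x _; rewrite lee_fin addr_ge0// mulr_ge0.
  - by apply/measurable_EFinP; apply: measurable_funD => //; exact: mZ.
  - by apply/measurable_EFinP; apply: measurable_funD => //; exact: mZ.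
  - by move=> x _; rewrite lee_fin.
exact: leeD2l.
Qed.

Lemma divfK_le (R : realType) (x y : R) : 0 <= x -> x <= y -> x / y * y = x.
Proof.
move=> x0 xy; have [y0|y0] := eqVneq y 0; last by rewrite divfK.
by apply/eqP; rewrite y0 mulr0 eq_sym eq_le x0 andbT -y0.
Qed.

Lemma measurable_powR_comp d (T : measurableType d) (R : realType) (p : R)
    (f : T -> R) :
  measurable_fun setT f -> measurable_fun setT (fun x => f x `^ p).
Proof. by move=> mf; exact: (measurableT_comp (measurable_powR p) mf). Qed.

(** Jensen's inequality for the concave envelope, applied to 3 M / S under the
    measure S dmu. The tangent at any G in (0, 1] with 3 int M <= G int S gives
    int h <= g(G) int S. One takes G = Gamma when Gamma > 0, lets G tend to 0
    when Gamma = 0, and takes G = 1 when int S = 0. *)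
Lemma integral_ineq d (T : measurableType d) (R : realType)
    (mu : {measure set T -> \bar R}) (p : R) (a b c : T -> R) : 3 <= p ->
  measurable_fun setT a -> measurable_fun setT b -> measurable_fun setT c ->
  (forall x, 0 <= a x) -> (forall x, 0 <= b x) -> (forall x, 0 <= c x) ->
  (\int[mu]_x (a x `^ p + b x `^ p + c x `^ p)%R%:E < +oo)%E ->
  (\int[mu]_x ((a x + b x + c x) `^ p)%R%:E <=
   (envelope p (fine (\int[mu]_x (pair_mean p (a x) (b x) (c x))%:E)%E
      / (3^-1 * fine (\int[mu]_x (a x `^ p + b x `^ p + c x `^ p)%R%:E)%E)))%R%:E
   * \int[mu]_x (a x `^ p + b x `^ p + c x `^ p)%R%:E)%E.
Proof.
move=> p3 ma mb mc a0 b0 c0.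
pose h x := (a x + b x + c x) `^ p.
pose S x := a x `^ p + b x `^ p + c x `^ p.
pose M x := pair_mean p (a x) (b x) (c x).
rewrite -/(S _) => Sfin.
have p0 : 0 < p by lra.
have mh : measurable_fun setT h.
  apply: measurable_powR_comp; apply: measurable_funD => //.
  exact: measurable_funD.
have mS : measurable_fun setT S.
  by do 2?[apply: measurable_funD]; exact: measurable_powR_comp.
have mM : measurable_fun setT M.
  apply: measurable_powR_comp; apply: measurable_funM; first exact: measurable_cst.
  by do 2?[apply: measurable_funD]; exact: measurable_funM.
have h0 x : 0 <= h x by apply: powR_ge0.
have S0 x : 0 <= S x by rewrite !addr_ge0// powR_ge0.
have M0 x : 0 <= M x by apply: powR_ge0.
have env0 t : 0 <= envelope p t by apply: powR_ge0.
have MS x : 3 * M x <= S x by apply: pair_mean_le => //; lra.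
have gam01 x : 0 <= 3 * M x / S x <= 1.
  rewrite divr_ge0 ?mulr_ge0//=.
  have := S0 x; rewrite le_eqVlt => /predU1P[<-|Sx0]; first by rewrite invr0 mulr0.
  by rewrite ler_pdivrMr// mul1r.
have below G : 0 < G -> G <= 1 ->
    (3%:E * \int[mu]_x (M x)%:E <= G%:E * \int[mu]_x (S x)%:E)%E ->
    (\int[mu]_x (h x)%:E <= (envelope p G)%:E * \int[mu]_x (S x)%:E)%E.
  move=> G0 G1 GMS; have [D D0 tangent] := envelope_tangent p3 G0 G1.
  apply: (@integral_le_affine_majorant _ _ _ _ h S M _ (D * G) (D * 3)) => //.
  - by rewrite mulr_ge0// ltW.
  - by rewrite mulr_ge0.
  - move=> x; have /andP[g0 g1] := gam01 x.
    have := pointwise_ineq p3 (a0 x) (b0 x) (c0 x).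
    rewrite -/(S x) -/(M x) -/(h x) => hx.
    have tx := ler_wpM2r (S0 x) (tangent _ g0 g1).
    have gS : 3 * M x / S x * S x = 3 * M x.
      by apply: divfK_le (MS x); exact: mulr_ge0.
    apply: le_trans (_ : envelope p (3 * M x / S x) * S x + D * G * S x <= _).
      by rewrite lerD2r.
    have split t : (envelope p G + D * (t - G)) * S x
        = envelope p G * S x + D * (t * S x) - D * G * S x by ring.
    by rewrite -lerBrDr; apply: le_trans tx _; rewrite split gS mulrA.
  - by rewrite !EFinM -!muleA; apply: lee_wpmul2l.
pose mI := fine (\int[mu]_x (M x)%:E)%E; pose sI := fine (\int[mu]_x (S x)%:E)%E.
have S_ge0 : (0 <= \int[mu]_x (S x)%:E)%E.
  by apply: integral_ge0 => x _; rewrite lee_fin.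
have M_ge0 : (0 <= \int[mu]_x (M x)%:E)%E.
  by apply: integral_ge0 => x _; rewrite lee_fin.
have sE : (\int[mu]_x (S x)%:E = sI%:E)%E by rewrite fineK// ge0_fin_numE.
have M_le : (\int[mu]_x (M x)%:E <= (3^-1)%:E * \int[mu]_x (S x)%:E)%E.
  apply: (@integral_le_affine_majorant _ _ _ _ M S M _ 0 0) => //.
  - by move=> x; rewrite !mul0r !addr0 mulrC ler_pdivlMr// mulrC.
  - by rewrite !mul0e.
have mE : (\int[mu]_x (M x)%:E = mI%:E)%E.
  rewrite fineK// ge0_fin_numE//; apply: le_lt_trans M_le _.
  by rewrite sE -EFinM ltry.
have mI0 : 0 <= mI by rewrite fine_ge0.
have sI0 : 0 <= sI by rewrite fine_ge0.
have ms : 3 * mI <= sI.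
  by move: M_le; rewrite mE sE -EFinM lee_fin mulrC ler_pdivlMr// mulrC.
rewrite -/(M _) -/mI -/sI.
have below' G : 0 < G -> G <= 1 -> 3 * mI <= G * sI ->
    (\int[mu]_x (h x)%:E <= (envelope p G * sI)%R%:E)%E.
  by move=> G0 G1 le; rewrite EFinM -sE; apply: below => //; rewrite mE sE -!EFinM lee_fin.
rewrite sE -EFinM.
move: sI0; rewrite le_eqVlt => /predU1P[sIE|sI0].
  rewrite -sIE mulr0 -(mulr0 (envelope p 1)) sIE; apply: below' => //.
  by rewrite mul1r.
set Gam := mI / (3^-1 * sI).
have GamE : 3 * mI = Gam * sI by rewrite /Gam; field; rewrite gt_eqF.
have : 0 <= Gam by rewrite divr_ge0// mulr_ge0// ltW.
rewrite le_eqVlt => /predU1P[Gam0|Gam0]; last first.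
  apply: below' => //; last by rewrite GamE.
  by rewrite -(ler_pM2r sI0) -GamE mul1r.
rewrite -Gam0 envelope0 ?mul1r; last by lra.
have be0 : 0 < beta3 p by apply: beta3_gt0; lra.
apply/lee_addgt0Pr => eps eps0.
(* G is chosen so that the chord bound makes the excess G^beta K at most eps. *)
pose K := 3 `^ (p - 1) * sI.
have K0 : 0 < K by rewrite mulr_gt0// powR_gt0.
pose s := Num.min 1 (eps / K).
have s0 : 0 < s by rewrite lt_min ltr01 divr_gt0.
have s1 : s <= 1 by rewrite ge_min lexx.
have sK : s * K <= eps by rewrite -ler_pdivlMr// ge_min lexx orbT.
pose G := s `^ (beta3 p)^-1.
have G0 : 0 < G by rewrite powR_gt0.
have G1 : G <= 1.
  rewrite -[leRHS](_ : 1 `^ (beta3 p)^-1 = 1); last by rewrite powR1.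
  by apply: powR_le_base => //; [rewrite invr_ge0 ltW|exact: ltW].
apply: le_trans (below' G G0 G1 _) _.
  by rewrite GamE -Gam0 mul0r mulr_ge0// ltW.
rewrite -EFinD lee_fin.
have := envelope_le_chord p3 (ltW G0) G1.
rewrite /G -powRrM mulVf ?(gt_eqF be0)// powRr1 ?(ltW s0)// -/G => chord.
apply: le_trans (ler_wpM2r (ltW sI0) chord) _.
by rewrite mulrDl mul1r lerD2l -mulrA.
Qed.

(** * The modulus and the norm of complex functions *)

Lemma cmodE (R : realType) (z : R[i]) : cmod z = ComplexField.Normc.normc z.
Proof. by []. Qed.

Lemma cmod_ge0 (R : realType) (z : R[i]) : 0 <= cmod z.
Proof. by rewrite /cmod normc_def/= sqrtr_ge0. Qed.

Lemma cmodM (R : realType) (z w : R[i]) : cmod (z * w) = cmod z * cmod w.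
Proof. by rewrite !cmodE ComplexField.Normc.normcM. Qed.

Lemma cmodD (R : realType) (z w : R[i]) : cmod (z + w) <= cmod z + cmod w.
Proof. by rewrite !cmodE; exact: le_normcD. Qed.

Lemma measurable_cmod d (T : measurableType d) (R : realType) (f : T -> R[i]) :
  measurable_fun setT (fun x => complex.Re (f x)) ->
  measurable_fun setT (fun x => complex.Im (f x)) ->
  measurable_fun setT (fun x => cmod (f x)).
Proof.
move=> mRe mIm.
rewrite (_ : (fun x => cmod (f x)) = fun x =>
  (complex.Re (f x) ^+ 2 + complex.Im (f x) ^+ 2) `^ 2^-1).
  apply: measurable_powR_comp.
  by apply: measurable_funD; exact: measurable_funX.
apply/funext => x; rewrite powR12_sqrt ?addr_ge0 ?sqr_ge0//.
by rewrite /cmod normc_def.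
Qed.

Lemma powR_Lnorm_real d (T : measurableType d) (R : realType)
    (mu : {measure set T -> \bar R}) (r : R) (f : T -> R) :
  r != 0 -> (forall x, 0 <= f x) ->
  ('N[mu]_(r%:E)[(fun x => (f x)%:E)] `^ r = \int[mu]_x (f x `^ r)%R%:E)%E.
Proof.
move=> r0 f0; rewrite (poweR_Lnorm _ _ r0).
by apply: eq_integral => x _; rewrite /= ger0_norm// poweR_EFin.
Qed.

(** * The inequality for three functions *)

Lemma poweR_root_le (R : realType) (p A : R) (x N : \bar R) :
  0 < p -> 0 <= A -> (0 <= x)%E -> (0 <= N)%E ->
  (x `^ p <= (A `^ (p - 1))%:E * N)%E ->
  (x <= (A `^ (conj_exp p)^-1)%:E * N `^ p^-1)%E.
Proof.
move=> p0 A0 x0 N0 le.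
have -> : x = ((x `^ p) `^ p^-1)%E by rewrite -poweRrM mulfV ?gt_eqF// poweRe1.
have Ap0 : 0 <= A `^ (p - 1) by exact: powR_ge0.
have -> : (conj_exp p)^-1 = (p - 1) * p^-1 by rewrite /conj_exp invf_div.
rewrite powRrM -poweR_EFin -poweRM//.
apply: gt0_ler_poweR => //.
- by rewrite invr_ge0 ltW.
- by rewrite in_itv/= poweR_ge0 leey.
- by rewrite in_itv/= leey andbT mule_ge0.
Qed.

Unset Implicit Arguments.

Theorem theorem1p4 (R : realType) (d : measure_display) (T : measurableType d)
    (mu : {measure set T -> \bar R}) (p : R) (hp : 3 <= p)
    (f1 f2 f3 : T -> R[i])
    (hf1 : cLfun mu p f1) (hf2 : cLfun mu p f2) (hf3 : cLfun mu p f3)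
    (hf : ~ ({ae mu, forall x, f1 x = 0} /\ {ae mu, forall x, f2 x = 0} /\
             {ae mu, forall x, f3 x = 0})) :
  (cLnorm mu p (fun x => (f1 x + f2 x + f3 x)%R)
   <= ((1 + 2 * Gamma mu p f1 f2 f3 `^ beta3 p) `^ (conj_exp p)^-1)%R%:E
      * (cLnorm mu p f1 `^ p + cLnorm mu p f2 `^ p + cLnorm mu p f3 `^ p)
          `^ p^-1)%E.
Proof.
have p0 : 0 < p by lra.
have p_neq0 : p != 0 by rewrite gt_eqF.
have [mRe1 mIm1 fin1] := hf1; have [mRe2 mIm2 fin2] := hf2.
have [mRe3 mIm3 fin3] := hf3.
pose a x := cmod (f1 x); pose b x := cmod (f2 x); pose c x := cmod (f3 x).
have ma : measurable_fun setT a by exact: measurable_cmod.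
have mb : measurable_fun setT b by exact: measurable_cmod.
have mc : measurable_fun setT c by exact: measurable_cmod.
have a0 x : 0 <= a x by exact: cmod_ge0.
have b0 x : 0 <= b x by exact: cmod_ge0.
have c0 x : 0 <= c x by exact: cmod_ge0.
have normE f : (cLnorm mu p f `^ p = \int[mu]_x (cmod (f x) `^ p)%R%:E)%E.
  by rewrite /cLnorm powR_Lnorm_real// => x; exact: cmod_ge0.
have mpow (f : T -> R) : measurable_fun setT f ->
    measurable_fun setT (fun x => (f x `^ p)%R%:E).
  by move=> mf; apply/measurable_EFinP; exact: measurable_powR_comp.
have sumE : (cLnorm mu p f1 `^ p + cLnorm mu p f2 `^ p + cLnorm mu p f3 `^ p
    = \int[mu]_x (a x `^ p + b x `^ p + c x `^ p)%R%:E)%E.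
  rewrite !normE.
  under [in RHS]eq_integral do rewrite !EFinD.
  rewrite ge0_integralD//; first last.
  - exact: mpow.
  - by move=> x _; rewrite lee_fin powR_ge0.
  - by apply: emeasurable_funD; exact: mpow.
  - by move=> x _; rewrite -EFinD lee_fin addr_ge0 ?powR_ge0.
  rewrite ge0_integralD//; try exact: mpow;
    by move=> x _; rewrite lee_fin powR_ge0.
have sum_fin : (\int[mu]_x (a x `^ p + b x `^ p + c x `^ p)%R%:E < +oo)%E.
  by rewrite -sumE !lte_add_pinfty// poweR_lty.
have GammaE : (1 + 2 * Gamma mu p f1 f2 f3 `^ beta3 p) `^ (p - 1) =
    envelope p (fine (\int[mu]_x (pair_mean p (a x) (b x) (c x))%:E)%E
      / (3^-1 * fine (\int[mu]_x (a x `^ p + b x `^ p + c x `^ p)%R%:E)%E)).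
  rewrite /envelope /Gamma sumE powR_Lnorm_real; last 2 first.
  - by rewrite gt_eqF// divr_gt0.
  - by move=> x; rewrite mulr_ge0 ?invr_ge0// !addr_ge0// cmod_ge0.
  by under eq_integral do rewrite !cmodM.
have := integral_ineq hp ma mb mc a0 b0 c0 sum_fin.
rewrite -GammaE -sumE => main.
set N := (_ + _ + _)%E in main *.
have N0 : (0 <= N)%E.
  by apply: adde_ge0; [apply: adde_ge0|]; exact: poweR_ge0.
have m_sum : measurable_fun setT (fun x => cmod (f1 x + f2 x + f3 x)).
  apply: measurable_cmod.
    rewrite (_ : (fun x => _) = fun x => complex.Re (f1 x)
      + complex.Re (f2 x) + complex.Re (f3 x)).
      by do 2?[apply: measurable_funD].
    by apply/funext => x; rewrite !raddfD.
  rewrite (_ : (fun x => _) = fun x => complex.Im (f1 x)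
    + complex.Im (f2 x) + complex.Im (f3 x)).
    by do 2?[apply: measurable_funD].
  by apply/funext => x; rewrite !raddfD.
have m_abc : measurable_fun setT (fun x => a x + b x + c x).
  by do 2?[apply: measurable_funD].
have sum_le : (cLnorm mu p (fun x => (f1 x + f2 x + f3 x)%R) `^ p
    <= \int[mu]_x ((a x + b x + c x) `^ p)%R%:E)%E.
  rewrite normE; apply: (ge0_le_integral mu measurableT).
  - by move=> x _; rewrite lee_fin; exact: powR_ge0.
  - exact: (mpow _ m_sum).
  - exact: (mpow _ m_abc).
  - move=> x _; rewrite lee_fin.
    apply: powR_le_base; [exact: ltW|exact: cmod_ge0|].
    by apply: le_trans (cmodD _ _) _; rewrite lerD2r; exact: cmodD.
have A0 : 0 <= 1 + 2 * Gamma mu p f1 f2 f3 `^ beta3 p.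
  exact: envelope_base_ge0.
exact: (poweR_root_le p0 A0 (Lnorm_ge0 _ _ _) N0 (le_trans sum_le main)).
Qed.
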